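(* Let $G$ be an ample Hausdorff groupoid, let $K$ be a field, and let $c:G\to H$ be a continuous cocycle into a discrete group $H$. Then the Steinberg algebra $A_K(G)$ is locally finite for the $H$-grading induced by $c$ (i.e. every homogeneous component $A_K(G)_h$, $h\in H$, is a finite-dimensional $K$-vector space) if and only if $|c^{-1}(h)|<\infty$ for all $h\in H$.
   Context: An ample Hausdorff groupoid is a locally compact Hausdorff étale topological groupoid $G$ having a basis of compact open bisections, where a bisection is a set $U\subseteq G$ such that the range map $r$ and the source map $s$ restrict to bijections from $U$ onto $r(U)$ and $s(U)$. A cocycle is a groupoid homomorphism $c:G\to H$, i.e. $c(\gamma\eta)=c(\gamma)c(\eta)$ whenever $\gamma\eta$ is defined. The Steinberg algebra is $A_K(G)=\mathrm{span}_K\{1_U: U\subseteq G\text{ a compact open bisection}\}$ (a space of functions $G\to K$), with convolution product, determined by $1_U*1_V=1_{UV}$. The cocycle $c$ induces the $H$-grading $A_K(G)=\bigoplus_{h\in H}A_K(G)_h$, where $A_K(G)_h=\mathrm{span}_K\{1_U: U\subseteq c^{-1}(h)\text{ a compact open bisection}\}$. *)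

(* Defs.v *)
From HB Require Import structures.
From mathcomp Require Import all_boot all_order all_algebra.
From mathcomp Require Import boolp classical_sets functions fsbigop cardinality.
From mathcomp Require Import topology numfun.

Set Implicit Arguments.
Unset Strict Implicit.
Unset Printing Implicit Defensive.

Import GRing.Theory.

Local Open Scope classical_set_scope.
Local Open Scope ring_scope.

(* A groupoid is presented by its set of arrows, a unit being identified with
   its identity arrow. The product is a total function whose values are
   unconstrained outside the composable pairs (x, y), those with
   source x = range y. *)
HB.mixin Record isGroupoid (G : Type) := {
  gsrc : G -> G;
  grng : G -> G;
  gmul : G -> G -> G;
  ginv : G -> G;
  gsrc_rng : forall x, gsrc (grng x) = grng x;
  grng_src : forall x, grng (gsrc x) = gsrc x;
  gsrcM : forall x y, gsrc x = grng y -> gsrc (gmul x y) = gsrc y;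
  grngM : forall x y, gsrc x = grng y -> grng (gmul x y) = grng x;
  gmulA : forall x y z, gsrc x = grng y -> gsrc y = grng z ->
    gmul x (gmul y z) = gmul (gmul x y) z;
  gmul_rng : forall x, gmul (grng x) x = x;
  gmul_src : forall x, gmul x (gsrc x) = x;
  gsrcV : forall x, gsrc (ginv x) = grng x;
  grngV : forall x, grng (ginv x) = gsrc x;
  gmulV : forall x, gmul x (ginv x) = grng x;
  gmulVx : forall x, gmul (ginv x) x = gsrc x;
}.

#[short(type="groupoidType")]
HB.structure Definition Groupoid := {G of isGroupoid G}.

Definition composable (G : groupoidType) : set (G * G) :=
  [set p | gsrc p.1 = grng p.2].
Arguments composable G : clear implicits.

Definition unit_space (G : groupoidType) : set G := range (@gsrc G).
Arguments unit_space G : clear implicits.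

HB.mixin Record isTopologicalGroupoid (G : Type)
    of Groupoid G & Topological G := {
  continuous_gmul :
    {within composable G, continuous (fun p : G * G => gmul p.1 p.2)};
  continuous_ginv : continuous (@ginv G);
}.

#[short(type="topologicalGroupoidType")]
HB.structure Definition TopologicalGroupoid :=
  {G of Groupoid G & Topological G & isTopologicalGroupoid G}.

(* [f], which takes its values in [B], is a local homeomorphism from [X] to [B]
   with the topology induced by [Y]; [g] is the inverse of [f : U -> f @` U]. *)
Definition local_homeomorphism (X Y : topologicalType) (B : set Y)
    (f : X -> Y) : Prop :=
  range f `<=` B /\
  forall x, exists U : set X,
    [/\ open U, U x, open (f @` U : set (subspace B)),
        {within U, continuous f}
      & exists2 g : Y -> X,
          {within f @` U, continuous g} & {in U, cancel f g}].

Definition etale (G : topologicalGroupoidType) : Prop :=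
  local_homeomorphism (unit_space G) (@grng G) /\
  local_homeomorphism (unit_space G) (@gsrc G).
Arguments etale G : clear implicits.

Definition bisection (G : groupoidType) (U : set G) : Prop :=
  set_bij U (@grng G @` U) (@grng G) /\ set_bij U (@gsrc G @` U) (@gsrc G).

Definition compact_open_bisection (G : topologicalGroupoidType) (U : set G)
    : Prop :=
  [/\ compact U, open U & bisection U].

Definition ample_hausdorff (G : topologicalGroupoidType) : Prop :=
  [/\ locally_compact [set: G], hausdorff_space G, etale G
    & exists2 B : set (set G),
        basis B & forall U, B U -> compact_open_bisection U].
Arguments ample_hausdorff G : clear implicits.

Definition cocycle (G : groupoidType) (H : groupType) (c : G -> H) : Prop :=
  forall x y : G, gsrc x = grng y -> c (gmul x y) = (c x * c y)%g.

Definition linear_span (K : fieldType) (V : lmodType K) (S : set V) : set V :=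
  [set v | exists n (a : 'I_n -> K) (w : 'I_n -> V),
    (forall i, S (w i)) /\ v = \sum_(i < n) a i *: w i].

Definition linearly_independent (K : fieldType) (V : lmodType K) (n : nat)
    (b : 'I_n -> V) : Prop :=
  forall a : 'I_n -> K, \sum_(i < n) a i *: b i = 0 -> forall i, a i = 0.

(* The set [W] of vectors is a subspace with a finite basis. *)
Definition finite_dimensional (K : fieldType) (V : lmodType K) (W : set V)
    : Prop :=
  exists n (b : 'I_n -> V), linearly_independent b /\
    W = range (fun a : 'I_n -> K => \sum_(i < n) a i *: b i).

Section Steinberg.
Variables (G : topologicalGroupoidType) (K : fieldType).

(* [K^o] is [K] seen as a vector space over itself, so that [G -> K^o] has the
   pointwise vector space structure. *)
Definition steinberg_algebra : set (G -> K^o) :=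
  linear_span [set (\1_U : G -> K^o) | U in @compact_open_bisection G].

(* The sum has finite support when [f] and [g] are in [steinberg_algebra]. *)
Definition convolution (f g : G -> K^o) : G -> K^o := fun x =>
  \sum_(p \in [set p | composable G p /\ gmul p.1 p.2 = x]) (f p.1 * g p.2).

Definition steinberg_component (H : Type) (c : G -> H) (h : H)
    : set (G -> K^o) :=
  linear_span [set (\1_U : G -> K^o)
    | U in [set U | compact_open_bisection U /\ U `<=` c @^-1` [set h]]].

End Steinberg.
Arguments steinberg_algebra G K : clear implicits.
Arguments steinberg_component {G} K {H} c h.

(* [W] is the family of the homogeneous components of a graded algebra. *)
Definition locally_finite (K : fieldType) (V : lmodType K) (H : Type)
    (W : H -> set V) : Prop :=
  forall h, finite_dimensional (W h).

Lemma steinberg_component_sub (G : topologicalGroupoidType) (K : fieldType)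
    (H : Type) (c : G -> H) (h : H) :
  steinberg_component K c h `<=` steinberg_algebra G K.
Proof.
move=> f [n [a [w [Sw ->]]]]; exists n, a, w; split=> // i.
by have [U [cU _] <-] := Sw i; exists U.
Qed.

Lemma convolution_indic (G : topologicalGroupoidType) (K : fieldType)
    (U V : set G) : bisection U -> bisection V ->
  convolution (\1_U : G -> K^o) (\1_V : G -> K^o) =
  \1_[set gmul p.1 p.2 | p in composable G `&` (U `*` V)].
Proof.
move=> [[_ injU _] _] [_ [_ injV _]]; apply/funext => x; rewrite /convolution.
have [[[y z] [cyz [/= Uy Vz]] yzx]|nx] :=
  pselect ([set gmul p.1 p.2 | p in (composable G `&` (U `*` V))] x).
- rewrite [RHS]indicE mem_set; last by exists (y, z).
  rewrite -(@fsbig_widen _ _ _ _ [set (y, z)]).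
  + by rewrite fsbig_set1 /= !indicE !mem_set // mulr1.
  + by move=> _ ->.
  + move=> [y' z'] [[/= cyz' yzx'] ne] /=; rewrite !indicE.
    have [/set_mem Uy'|] := boolP (y' \in U); last by rewrite mul0r.
    have [/set_mem Vz'|] := boolP (z' \in V); last by rewrite mulr0.
    case: ne; rewrite /composable /= in cyz cyz'; congr (_, _).
    * by apply: injU; rewrite ?inE // -(grngM _ _ cyz') yzx' -yzx grngM.
    * by apply: injV; rewrite ?inE // -(gsrcM _ _ cyz') yzx' -yzx gsrcM.
- rewrite [RHS]indicE memNset // fsbig1 // => -[y z] [/= cyz yzx].
  rewrite !indicE.
  have [/set_mem Uy|] := boolP (y \in U); last by rewrite mul0r.
  have [/set_mem Vz|] := boolP (z \in V); last by rewrite mulr0.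
  by case: nx; exists (y, z).
Qed.

(* Main.v *)
Require Import Defs.
From mathcomp Require Import all_boot all_order all_algebra.
From mathcomp Require Import boolp classical_sets functions fsbigop cardinality.
From mathcomp Require Import topology numfun.

(** Everything happens on the single fibre [F] of [c] over [h], which is open
    because [H] is discrete; the component of degree [h] is spanned by the
    indicators of the compact open bisections inside [F].

    If [F] is finite, the Hausdorff property makes each of its points open, so
    the singletons of [F] are compact open bisections. Their indicators lie in
    the component, and every function vanishing off [F] is uniquely a linear
    combination of them: they form a basis
    ([finite_dimensional_span_indic]).

    If [F] is infinite, take arbitrarily many points in it. Deleting the other
    chosen points from [F] leaves an open neighbourhood of each one, and this
    neighbourhood contains a compact open bisection around the point. The
    indicators of these bisections are dual to evaluation at the chosen points
    ([separating_bisection]), so they are linearly independent, which bounds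
    the number of points by the dimension of the component
    ([finite_dimensional_dual_bound]). *)

Set Implicit Arguments.
Unset Strict Implicit.
Unset Printing Implicit Defensive.

Import GRing.Theory.

Local Open Scope classical_set_scope.

Lemma open_fiber_discrete (X : topologicalType) (T : choiceType) (f : X -> T)
    (t : T) :
  continuous (f : X -> discrete_topology T) -> open (f @^-1` [set t]).
Proof. by move=> /continuousP; apply; exact: discrete_open. Qed.

Lemma open_setD_finite (X : topologicalType) (F A : set X) :
  hausdorff_space X -> open F -> finite_set A -> open (F `\` A).
Proof.
move=> /hausdorff_accessible/accessible_finite_set_closed finC oF finA.
by apply: openI => //; apply: closed_openC; exact: finC.
Qed.

Lemma open_set1_finite (X : topologicalType) (F : set X) (x : X) :
  hausdorff_space X -> open F -> finite_set F -> F x -> open [set x].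
Proof.
move=> hX oF finF Fx; have -> : [set x] = F `\` (F `\ x).
  by rewrite setDD; apply/seteqP; split=> [_ ->|y []].
by apply: open_setD_finite => //; exact: finite_setD.
Qed.

Lemma bisection_set1 (G : groupoidType) (x : G) : bisection [set x].
Proof. by split; split=> // y z /set_mem -> /set_mem ->. Qed.

Lemma compact_open_bisection_set1 (G : topologicalGroupoidType) (F : set G)
    (x : G) :
  hausdorff_space G -> open F -> finite_set F -> F x ->
  compact_open_bisection [set x].
Proof.
move=> hG oF finF Fx; split; [exact: compact_set1| |exact: bisection_set1].
exact: open_set1_finite finF Fx.
Qed.

(** The chosen points other than [x] form a finite, hence closed, set; removing
    them from [F] leaves an open neighbourhood of [x]. *)
Lemma separating_bisection (G : topologicalGroupoidType) (F A : set G)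
    (x : G) :
  ample_hausdorff G -> open F -> finite_set A -> F x ->
  exists U, [/\ compact_open_bisection U, U `<=` F, U x
    & forall y, A y -> U y -> y = x].
Proof.
move=> [_ hG _ [B [_ Bx] cB]] oF finA Fx.
have oV : open (F `\` (A `\ x)).
  by apply: open_setD_finite => //; exact: finite_setD.
have [U [/cB cU Ux] UV] : filter_from [set U | B U /\ U x] id (F `\` (A `\ x)).
  by apply: Bx; apply: open_nbhs_nbhs; split=> //; split=> // -[_ /(_ erefl)].
exists U; split=> // [y /UV[]//|y Ay /UV[_ nAy]].
by apply: contrapT => yx; apply: nAy.
Qed.

Lemma sub_linear_span (K : fieldType) (V : lmodType K) (S : set V) :
  S `<=` linear_span S.
Proof.
move=> v Sv; exists 1, (fun=> 1%R), (fun=> v).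
by split=> //; rewrite big_ord1 scale1r.
Qed.

Section FunctionSpace.
Local Open Scope ring_scope.
Variables (X : choiceType) (K : fieldType).

Lemma lincombE n (a : 'I_n -> K) (w : 'I_n -> X -> K^o) (x : X) :
  (\sum_i a i *: w i) x = \sum_i a i * w i x.
Proof. by rewrite fct_sumE. Qed.

(** The [w i] have coordinates forming an [m]-by-[n] matrix in a basis of [W],
    and the values of that basis at the [x j] form an [n]-by-[m] matrix; duality
    says that their product is the identity, whose rank is [m]. *)
Lemma finite_dimensional_dual_bound (W : set (X -> K^o)) :
  finite_dimensional W ->
  exists n, forall m (w : 'I_m -> X -> K^o) (x : 'I_m -> X),
    (forall i, W (w i)) -> (forall i j, w i (x j) = (i == j)%:R) ->
    (m <= n)%N.
Proof.
move=> [n [b [_ ->]]]; exists n => m w x Ww wx.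
have /choice[a aw] : forall i, exists a : 'I_n -> K,
    \sum_k a k *: b k = w i.
  by move=> i; have [a _ <-] := Ww i; exists a.
pose M := \matrix_(i < m, k < n) a i k.
pose N := \matrix_(k < n, j < m) (b k (x j) : K).
have MN : M *m N = 1%:M.
  apply/matrixP => i j; rewrite !mxE -wx -aw lincombE.
  by apply: eq_bigr => k _; rewrite !mxE.
by rewrite -(mxrank1 K m) -MN mulmx_max_rank.
Qed.

Lemma sum_indic_set1 (s : seq X) (a : 'I_(size s) -> K) (j : 'I_(size s)) :
  uniq s ->
  (\sum_i a i *: (\1_[set tnth (in_tuple s) i] : X -> K^o))
    (tnth (in_tuple s) j) = a j.
Proof.
move=> us; rewrite lincombE (bigD1 j) //= big1 ?addr0 => [|i ij].
  by rewrite indicE mem_set // mulr1.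
rewrite indicE memNset ?mulr0 // => /= eq_ji.
by move: ij; rewrite -(inj_eq (tuple_uniqP (in_tuple s) us)) eq_ji eqxx.
Qed.

Lemma linear_span_vanish (S : set (X -> K^o)) (F : set X) :
  (forall f, S f -> forall x, ~ F x -> f x = 0) ->
  forall f, linear_span S f -> forall x, ~ F x -> f x = 0.
Proof.
move=> S0 f [n [a [w [Sw ->]]]] x nFx; rewrite lincombE big1 // => i _.
by rewrite (S0 _ (Sw i)) // mulr0.
Qed.

(** The indicators of the points of [F] are a basis, the coordinate of [f] at
    a point being its value there. *)
Lemma finite_dimensional_span_indic (S : set (X -> K^o)) (F : set X) :
  finite_set F -> (forall x, F x -> S \1_[set x]) ->
  (forall f, S f -> forall x, ~ F x -> f x = 0) ->
  finite_dimensional (linear_span S).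
Proof.
move=> /finite_seqP[s0 F0] S1 S0; pose s := undup s0.
have us : uniq s by exact: undup_uniq.
have Fs x : F x <-> x \in s by rewrite F0 /= mem_undup.
pose b (i : 'I_(size s)) : X -> K^o := \1_[set tnth (in_tuple s) i].
exists (size s), b; split=> [a sum0 i|].
  by rewrite -(sum_indic_set1 a i us) -/(b) sum0.
apply/seteqP; split=> [f Sf|_ [a _ <-]]; last first.
  by exists (size s), a, b; split=> // i; apply: S1; rewrite Fs mem_tnth.
exists (fun i => f (tnth (in_tuple s) i)) => //; apply/funext => x.
have [xs|/negP xs] := boolP (x \in s).
  have /tnthP[i ->] : x \in in_tuple s by [].
  by rewrite (sum_indic_set1 _ i us).
rewrite (linear_span_vanish S0 Sf) ?Fs // lincombE big1 // => i _.
rewrite /b indicE memNset ?mulr0 // => /= xi.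
by apply: xs; rewrite xi mem_tnth.
Qed.

End FunctionSpace.

Theorem theorem3p6 (G : topologicalGroupoidType) (K : fieldType)
    (H : groupType) (c : G -> H) :
  ample_hausdorff G ->
  cocycle c ->
  continuous (c : G -> discrete_topology H) ->
  locally_finite (fun h : H => steinberg_component K c h) <->
  (forall h : H, finite_set (c @^-1` [set h])).
Proof.
move=> aG _ cc; have oF h := open_fiber_discrete h cc.
split=> [finW h|finF h]; last first.
  have [_ hG _ _] := aG; apply: finite_dimensional_span_indic (finF h) _ _.
    move=> x hx; exists [set x] => //; split; last by move=> _ ->.
    exact: compact_open_bisection_set1 hG (oF h) (finF h) hx.
  by move=> _ [U [_ UF] <-] x nFx; rewrite indicE memNset // => /UF.
apply: contrapT => infF.
have [n bound] := finite_dimensional_dual_bound (finW h).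
have [A AF] := infinite_set_fset n.+1 infF.
set s := finmap.enum_fset A => size_s.
pose x := tnth (in_tuple s).
have xs i : x i \in s by exact: mem_tnth.
have x_inj : injective x by apply/tuple_uniqP; exact: finmap.fset_uniq.
have /choice[U UP] : forall i, exists U, [/\ compact_open_bisection U,
    U `<=` c @^-1` [set h], U (x i) & forall y, [set` s] y -> U y -> y = x i].
  move=> i; apply: separating_bisection => //; last exact: AF (xs i).
  by apply/finite_seqP; exists s.
suff : (size s <= n)%N by rewrite leqNgt size_s.
apply: (bound _ (fun i => \1_(U i))%R x) => [i|i j].
  by have [cU UF _ _] := UP i; apply: sub_linear_span; exists (U i).
have [_ _ Ui Uj] := UP i; rewrite indicE; have [<-|ij] := eqVneq i j.
  by rewrite mem_set.
rewrite memNset // => /(Uj _ (xs j))/x_inj ji.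
by rewrite ji eqxx in ij.
Qed.
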